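(* Let $q\ge 1$, and for $i=1,\dots,q$ let $A_i\in\mathbb{R}^{n_i\times d_i}$. Put $n=\prod_{i=1}^q n_i$, $d=\prod_{i=1}^q d_i$, $\mathcal{A}=A_1\otimes A_2\otimes\cdots\otimes A_q\in\mathbb{R}^{n\times d}$, and let $b\in\mathbb{R}^n$. Let $\epsilon,\delta\in(0,1)$, let $m= 8(d_1d_2\cdots d_q+1)^2(2+3^q)/(\epsilon^2\delta)$, and let $S\in\mathbb{R}^{m\times n}$ be a random TensorSketch matrix with $m$ rows. Let $\widetilde{x}\in\arg\min_{x\in\mathbb{R}^d}\|S\mathcal{A}x-Sb\|_2$. Then with probability at least $1-\delta$, $$\|\mathcal{A}\widetilde{x}-b\|_2\le (1+\epsilon)\,\min_{x\in\mathbb{R}^d}\|\mathcal{A}x-b\|_2 .$$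
   Context: A TensorSketch matrix $S\in\mathbb{R}^{m\times n}$ with $n=\prod_{i=1}^q n_i$ is defined as follows. Choose $q$ independent 3-wise independent hash functions $h_i:[n_i]\to[m]$ and $q$ independent 4-wise independent sign functions $s_i:[n_i]\to\{-1,+1\}$. Index the coordinates of $\mathbb{R}^n$ by tuples $(i_1,\dots,i_q)$ with $i_k\in[n_k]$ (consistent with the Kronecker product ordering). Define $H(i_1,\dots,i_q)=\left(\sum_{k=1}^q h_k(i_k)\right)\bmod m$ and $\sigma(i_1,\dots,i_q)=\prod_{k=1}^q s_k(i_k)$. Then $S$ is the matrix whose column indexed by $(i_1,\dots,i_q)$ has exactly one nonzero entry, equal to $\sigma(i_1,\dots,i_q)$, located in row $H(i_1,\dots,i_q)$ (i.e. $S$ is the CountSketch matrix with hash $H$ and sign $\sigma$). *)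

(* Defs.v *)
From HB Require Import structures.
From mathcomp Require Import all_boot all_order all_algebra.
From mathcomp Require Import mxtens.
From mathcomp Require Import all_classical all_reals all_analysis.

Set Implicit Arguments.
Unset Strict Implicit.
Unset Printing Implicit Defensive.

Import Order.TTheory GRing.Theory Num.Theory.

Local Open Scope classical_set_scope.
Local Open Scope ring_scope.

(* The k-th entry (i_1, ..., i_q)_k of the tuple with lexicographic rank i,
   the last entry varying fastest, as in the Kronecker product. *)
Lemma digit_subproof (q : nat) (n : 'I_q -> nat) (i : 'I_(\prod_k n k)%N)
    (k : 'I_q) :
  ((i %/ \prod_(l < q | (k < l)%N) n l) %% n k < n k)%N.
Proof.
have N0 : (0 < \prod_k n k)%N by exact: leq_ltn_trans (ltn_ord i).
rewrite ltn_mod; move: N0; rewrite [X in (0 < X)%N](bigD1 k) //= muln_gt0.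
by case/andP.
Qed.

Definition digit (q : nat) (n : 'I_q -> nat) (i : 'I_(\prod_k n k)%N)
    (k : 'I_q) : 'I_(n k) :=
  Ordinal (digit_subproof i k).

Definition kron (R : comNzRingType) (q : nat) (n d : 'I_q -> nat)
    (A : forall k, 'M[R]_(n k, d k)) :
    'M[R]_((\prod_k n k)%N, (\prod_k d k)%N) :=
  \matrix_(i, j) \prod_k A k (digit i k) (digit j k).

Lemma digit0 (q : nat) (n : 'I_q.+1 -> nat) (i : 'I_(\prod_k n k)%N) :
  digit i ord0 = (i %/ \prod_k n (lift ord0 k))%N :> nat.
Proof.
have -> : (\prod_k n (lift ord0 k) = \prod_(l < q.+1 | (0 < l)%N) n l)%N.
  by rewrite [RHS]big_mkcond big_ord_recl /= mul1n.
have nE : (n ord0 * \prod_(l < q.+1 | (0 < l)%N) n l = \prod_k n k)%N.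
  by rewrite [RHS]big_ord_recl big_mkcond big_ord_recl /= mul1n.
have ilt : (i < n ord0 * \prod_(l < q.+1 | (0 < l)%N) n l)%N.
  by rewrite nE; exact: ltn_ord.
rewrite /= modn_small // ltn_divLR // lt0n.
by apply: contraTneq ilt => ->; rewrite muln0.
Qed.

Lemma digitS (q : nat) (n : 'I_q.+1 -> nat) (i : 'I_(\prod_k n k)%N)
    (j : 'I_(\prod_k n (lift ord0 k))%N) (k : 'I_q) :
  j = (i %% \prod_k n (lift ord0 k))%N :> nat ->
  digit i (lift ord0 k) = digit j k.
Proof.
move=> ji; apply: val_inj => /=; rewrite ji.
have -> : (\prod_(l < q.+1 | (bump 0 k < l)%N) n l =
           \prod_(l < q | (k < l)%N) n (lift ord0 l))%N.
  rewrite big_mkcond big_ord_recl /= mul1n -big_mkcond /=.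
  by apply: eq_bigl => l; rewrite /bump /= !add1n ltnS.
have : (0 < \prod_k n (lift ord0 k))%N by exact: leq_ltn_trans (ltn_ord j).
have /dvdnP[x ->] : (\prod_(l < q | (k < l)%N) n (lift ord0 l) *
    n (lift ord0 k) %| \prod_k n (lift ord0 k))%N.
  rewrite [X in (_ %| X)%N](bigID (fun l : 'I_q => (k < l)%N)) /= dvdn_mul //.
  by rewrite [X in (_ %| X)%N](bigD1 k) ?ltnn //= dvdn_mulr.
set p := (\prod_(l < q | _) _)%N; set a := n _; rewrite !muln_gt0.
case/and3P => x0 p0 a0.
rewrite [in LHS](divn_eq i (x * (p * a))).
rewrite (_ : _ * (x * _) = (i %/ (x * (p * a)) * x * a) * p)%N; last first.
  by rewrite -!mulnA (mulnC a p).
by rewrite divnMDl // modnMDl.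
Qed.

Lemma kron_recl (R : comNzRingType) (q : nat) (n d : 'I_q.+1 -> nat)
    (A : forall k, 'M[R]_(n k, d k)) :
  kron A = castmx (esym (big_ord_recl _ _), esym (big_ord_recl _ _))
             (A ord0 *t kron (fun k => A (lift ord0 k))).
Proof.
apply/matrixP => i j; rewrite castmxE !mxE; apply: (etrans (big_ord_recl _ _)).
congr (_ * _).
  by congr (A ord0 _ _); apply: val_inj; exact: digit0.
by apply: eq_bigr => k _; congr (A _ _ _); apply: digitS.
Qed.

Section random_elements.
Context (R : realType) (disp : measure_display) (T : measurableType disp).
Variable P : probability T R.

Definition finite_random_element (V : finType) (X : T -> V) : Prop :=
  forall B : set V, measurable (X @^-1` B).

(* All subsets of a finite V are events. *)
Definition mutually_independent (I : finType) (V : I -> finType)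
    (X : forall i, T -> V i) : Prop :=
  forall (J : {set I}) (B : forall i, set (V i)),
    P (\bigcap_(i in [set` J]) (X i @^-1` B i)) =
    (\prod_(i in J) P (X i @^-1` B i))%E.

(* Quantifying over at most k keys, rather than exactly k, keeps the definition
   meaningful when there are fewer than k keys; #|J| = 1 is uniformity. *)
Definition kwise_independent (k : nat) (D V : finType)
    (f : T -> {ffun D -> V}) : Prop :=
  forall (J : {set D}) (v : D -> V), (#|J| <= k)%N ->
    P [set w | forall x, x \in J -> f w x = v x] = (#|V|%:R^-1 ^+ #|J|)%:E.

End random_elements.

(* The sign functions s_k : [n_k] -> {-1, +1} are encoded by booleans,
   b standing for (-1) ^+ b. *)
Definition tensor_sketch_mx (R : realType) (q m : nat) (n : 'I_q -> nat)
    (h : forall k, {ffun 'I_(n k) -> 'I_m})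
    (s : forall k, {ffun 'I_(n k) -> bool}) : 'M[R]_(m, (\prod_k n k)%N) :=
  \matrix_(r, c)
    if r == ((\sum_k h k (digit c k)) %% m)%N :> nat
    then \prod_k (-1) ^+ s k (digit c k) else 0.

Definition seed_type (q m : nat) (n : 'I_q -> nat) (i : 'I_q + 'I_q) :
    finType :=
  match i with
  | inl k => {ffun 'I_(n k) -> 'I_m}
  | inr k => {ffun 'I_(n k) -> bool}
  end.

Definition seed (T : Type) (q m : nat) (n : 'I_q -> nat)
    (h : forall k, T -> {ffun 'I_(n k) -> 'I_m})
    (s : forall k, T -> {ffun 'I_(n k) -> bool}) (i : 'I_q + 'I_q) :
    T -> seed_type m n i :=
  match i with inl k => h k | inr k => s k end.

Definition random_tensor_sketch (R : realType) (disp : measure_display)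
    (T : measurableType disp) (P : probability T R) (q m : nat)
    (n : 'I_q -> nat) (S : T -> 'M[R]_(m, (\prod_k n k)%N)) : Prop :=
  exists (h : forall k, T -> {ffun 'I_(n k) -> 'I_m})
         (s : forall k, T -> {ffun 'I_(n k) -> bool}),
    [/\ forall i, finite_random_element (seed h s i),
        mutually_independent P (seed h s),
        forall k, kwise_independent P 3 (h k),
        forall k, kwise_independent P 4 (s k) &
        forall w, S w = tensor_sketch_mx R (fun k => h k w) (fun k => s k w)].

(* The canonical norm of matrices in the library is the max norm. *)
Definition norm2 (R : realType) (N : nat) (v : 'cV[R]_N) : R :=
  Num.sqrt (\sum_i v i 0 ^+ 2).

Definition lsq_argmin (R : realType) (M N : nat) (A : 'M[R]_(M, N))
    (b : 'cV[R]_M) : set 'cV[R]_N :=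
  [set x | forall y, norm2 (A *m x - b) <= norm2 (A *m y - b)].

(* The infimum is attained, so it is the minimum. *)
Definition lsq_min (R : realType) (M N : nat) (A : 'M[R]_(M, N))
    (b : 'cV[R]_M) : R :=
  inf [set norm2 (A *m x - b) | x in setT].

(* Main.v *)
(* Let K = S^T S - 1. Its entries vanish on the diagonal, and E[K c1 c2 * K c3 c4]
   is at most 1/m in absolute value and vanishes unless, for every k, the k-th
   entries of c1, c2, c3, c4 agree in pairs: by 4-wise independence a sign that
   occurs once averages out, and distinct tuples collide with probability at
   most 1/m because they differ in some entry. Summing over the three pairings
   of each entry and applying Cauchy-Schwarz one entry at a time gives
     E (x^T K y)^2 <= 3^q / m * |x|^2 |y|^2.
   Let the columns of U be an orthonormal basis of a space of dimension
   r <= d + 1 containing b and the columns of the Kronecker product. Then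
   E |U^T K U|_F^2 <= 3^q r^2 / m, so by Markov's inequality, with probability at
   least 1 - delta, S preserves squared norms on that space up to a factor
   1 +- eps / 2. Since (1 + eps / 2) <= (1 + eps)^2 (1 - eps / 2), a minimiser of
   the sketched problem is then (1 + eps)-optimal for the original one. *)

Require Import Defs.
From mathcomp Require Import all_boot all_order all_algebra.
From mathcomp Require Import mxtens ring lra.
From mathcomp Require Import all_classical all_reals all_analysis.

Import Order.TTheory GRing.Theory Num.Theory.

Set Implicit Arguments.
Unset Strict Implicit.
Unset Printing Implicit Defensive.

Local Open Scope classical_set_scope.
Local Open Scope ring_scope.

Lemma le_of_eq (d : Order.disp_t) (T : porderType d) (x y : T) : x = y -> (x <= y)%O.
Proof. by move=> ->. Qed.

(** * Cauchy-Schwarz and bounds on four-linear forms *)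

Section l2norm.
Variable R : rcfType.
Implicit Types I J : finType.

Lemma sum_sqr_ge0 I (f : I -> R) : 0 <= \sum_i f i ^+ 2.
Proof. by apply: sumr_ge0 => i _; exact: sqr_ge0. Qed.

(** Lagrange's identity: the double sum of squared 2 by 2 minors is twice the difference of the two
    sides. *)
Lemma sqr_sum_mul_le I (f g : I -> R) :
  (\sum_i f i * g i) ^+ 2 <= (\sum_i f i ^+ 2) * (\sum_i g i ^+ 2).
Proof.
have : 0 <= \sum_i \sum_j (f i * g j - f j * g i) ^+ 2.
  by apply: sumr_ge0 => i _; apply: sumr_ge0 => j _; exact: sqr_ge0.
suff -> : \sum_i \sum_j (f i * g j - f j * g i) ^+ 2 =
    ((\sum_i f i ^+ 2) * (\sum_i g i ^+ 2) - (\sum_i f i * g i) ^+ 2) *+ 2.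
  by rewrite pmulrn_lge0// subr_ge0.
rewrite mulr2n {2}[_ * _]mulrC expr2 !big_distrlr /= -!sumrB -big_split /=.
apply: eq_bigr => i _; rewrite -!sumrB -big_split /=.
by apply: eq_bigr => j _; ring.
Qed.

Definition l2norm I (f : I -> R) : R := Num.sqrt (\sum_i f i ^+ 2).

Lemma sqr_l2norm I (f : I -> R) : l2norm f ^+ 2 = \sum_i f i ^+ 2.
Proof. by rewrite sqr_sqrtr ?sum_sqr_ge0. Qed.

Lemma norm_sum_mul_le I (f g : I -> R) :
  `|\sum_i f i * g i| <= l2norm f * l2norm g.
Proof. by rewrite -sqrtrM ?sum_sqr_ge0// -sqrtr_sqr ler_wsqrtr ?sqr_sum_mul_le. Qed.

Lemma l2norm_bij I J (phi : J -> I) (f : I -> R) : bijective phi ->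
  l2norm (f \o phi) = l2norm f.
Proof. by move=> bphi; rewrite /l2norm [in RHS](reindex phi)//; exact: onW_bij. Qed.

Lemma l2norm_pair I J (f : I * J -> R) :
  l2norm (fun j => l2norm (fun i => f (i, j))) = l2norm f.
Proof.
congr Num.sqrt; under eq_bigr do rewrite sqr_l2norm.
by rewrite exchange_big pair_big; apply: eq_bigr => -[].
Qed.

Lemma l2norm_abs I (f : I -> R) : l2norm (fun i => `|f i|) = l2norm f.
Proof. by congr Num.sqrt; apply: eq_bigr => i _; rewrite real_normK ?num_real. Qed.

Definition kernel_form I (W : I -> I -> I -> I -> R) (f1 f2 f3 f4 : I -> R) : R :=
  \sum_(p : I * I * I * I) W p.1.1.1 p.1.1.2 p.1.2 p.2 *
    (f1 p.1.1.1 * f2 p.1.1.2 * f3 p.1.2 * f4 p.2).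

(** A one-sided bound suffices: replacing [f1] by its opposite yields the bound on the absolute
    value. *)
Definition kernel_bounded I (W : I -> I -> I -> I -> R) (C : R) : Prop :=
  forall f1 f2 f3 f4 : I -> R,
    kernel_form W f1 f2 f3 f4 <= C * (l2norm f1 * l2norm f2 * l2norm f3 * l2norm f4).

Lemma kernel_bounded_ext I (W W' : I -> I -> I -> I -> R) C :
  (forall a b c d, W a b c d = W' a b c d) ->
  kernel_bounded W C -> kernel_bounded W' C.
Proof.
move=> WW' H f1 f2 f3 f4; apply: le_trans (H f1 f2 f3 f4).
by apply: le_of_eq; apply: eq_bigr => p _; rewrite WW'.
Qed.

Lemma kernel_boundedD I (W W' : I -> I -> I -> I -> R) C C' :
  kernel_bounded W C -> kernel_bounded W' C' ->
  kernel_bounded (fun a b c d => W a b c d + W' a b c d) (C + C').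
Proof.
move=> H H' f1 f2 f3 f4; rewrite mulrDl; apply: le_trans (lerD (H _ _ _ _) (H' _ _ _ _)).
by apply: le_of_eq; rewrite -big_split; apply: eq_bigr => p _; rewrite mulrDl.
Qed.

Lemma kernel_bounded_bij I J (phi : J -> I) (W : I -> I -> I -> I -> R) C :
  bijective phi ->
  kernel_bounded (fun a b c d => W (phi a) (phi b) (phi c) (phi d)) C ->
  kernel_bounded W C.
Proof.
move=> bphi H f1 f2 f3 f4.
rewrite -(l2norm_bij f1 bphi) -(l2norm_bij f2 bphi) -(l2norm_bij f3 bphi).
rewrite -(l2norm_bij f4 bphi); apply: le_trans (H _ _ _ _); apply: le_of_eq.
rewrite /kernel_form.
rewrite (reindex (fun p : J * J * J * J =>
  (phi p.1.1.1, phi p.1.1.2, phi p.1.2, phi p.2)))//.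
case: bphi => psi phiK psiK; apply: onW_bij.
exists (fun p => (psi p.1.1.1, psi p.1.1.2, psi p.1.2, psi p.2)).
  by case=> -[] [] a b c d /=; rewrite !phiK.
by case=> -[] [] a b c d /=; rewrite !psiK.
Qed.

(* Contracting the first factor replaces each f by its partial l2 norms, to which
   the bound for the second factor applies. *)
Lemma kernel_bounded_tensor I J (W : I -> I -> I -> I -> R)
    (W' : J -> J -> J -> J -> R) C C' :
  (forall a b c d, 0 <= W' a b c d) -> 0 <= C ->
  kernel_bounded W C -> kernel_bounded W' C' ->
  kernel_bounded (fun a b c d : I * J =>
    W a.1 b.1 c.1 d.1 * W' a.2 b.2 c.2 d.2) (C * C').
Proof.
move=> W0 C0 H H' f1 f2 f3 f4.
pose g (f : I * J -> R) j := l2norm (fun i => f (i, j)).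
rewrite -(mulrA C) -(l2norm_pair f1) -(l2norm_pair f2) -(l2norm_pair f3) -(l2norm_pair f4).
apply: (@le_trans _ _ (C * kernel_form W' (g f1) (g f2) (g f3) (g f4))); last first.
  by apply: ler_wpM2l => //; exact: H'.
rewrite /kernel_form (reindex (fun p : (I * I * I * I) * (J * J * J * J) =>
  ((p.1.1.1.1, p.2.1.1.1), (p.1.1.1.2, p.2.1.1.2), (p.1.1.2, p.2.1.2), (p.1.2, p.2.2))));
  last first.
  apply: onW_bij; exists (fun p : (I * J) * (I * J) * (I * J) * (I * J) =>
    ((p.1.1.1.1, p.1.1.2.1, p.1.2.1, p.2.1), (p.1.1.1.2, p.1.1.2.2, p.1.2.2, p.2.2))).
    by case=> -[] [] [] a b c d [] [] [].
  by case=> -[] [] [] ? ? [] ? ? [] ? ? [].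
rewrite -(pair_bigA _ (fun (p : I * I * I * I) (r : J * J * J * J) =>
  W p.1.1.1 p.1.1.2 p.1.2 p.2 * W' r.1.1.1 r.1.1.2 r.1.2 r.2 *
  (f1 (p.1.1.1, r.1.1.1) * f2 (p.1.1.2, r.1.1.2) * f3 (p.1.2, r.1.2) *
   f4 (p.2, r.2)))) /= exchange_big /= mulr_sumr.
(* For fixed [r] the inner sum is the form of [W] on slices of the four functions; its bound can be
   multiplied by the weight of [r] because [W'] is nonnegative. *)
apply: ler_sum => r _; rewrite mulrCA.
under eq_bigr do rewrite mulrAC mulrC.
by rewrite -mulr_sumr; apply: ler_wpM2l => //; exact: H.
Qed.

(** The form splits into the inner product of [f1] and [f2] times that of [f3] and [f4];
    Cauchy-Schwarz bounds each. *)
Lemma kernel_bounded_pairing I :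
  kernel_bounded (fun a b c d : I => ((a == b) && (c == d))%:R) 1.
Proof.
move=> f1 f2 f3 f4.
have -> : kernel_form (fun a b c d => ((a == b) && (c == d))%:R) f1 f2 f3 f4 =
    (\sum_i f1 i * f2 i) * (\sum_i f3 i * f4 i).
  rewrite big_distrlr pair_big /= /kernel_form.
  rewrite (bigID (fun p : I * I * I * I => (p.1.1.1 == p.1.1.2) && (p.1.2 == p.2))) /=.
  rewrite [X in _ + X]big1 ?addr0; last first.
    by move=> p /negbTE ->; rewrite mul0r.
  rewrite (reindex_onto (fun r : I * I => (r.1, r.1, r.2, r.2))
    (fun p => (p.1.1.1, p.2))) /=; last first.
    by case=> -[] [] a b c d /= /andP[/eqP -> /eqP ->].
  rewrite (eq_bigl xpredT); last by case=> i j; rewrite !eqxx.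
  by apply: eq_bigr => -[i j] _ /=; rewrite !eqxx mul1r mulrA.
rewrite mul1r -mulrA; apply: le_trans (ler_norm _) _; rewrite normrM mulrA.
rewrite -[leRHS]mulrA; apply: ler_pM => //; exact: norm_sum_mul_le.
Qed.

(** The number of ways to match the four positions into pairs of equal values, so 3 when all
    coincide. Unlike an indicator, this count is a sum of three kernels that can be bounded
    separately. *)
Definition pairings (T : eqType) (a b c d : T) : R :=
  ((a == b) && (c == d))%:R + ((a == c) && (b == d))%:R + ((a == d) && (b == c))%:R.

Lemma pairings_ge0 (T : eqType) (a b c d : T) : 0 <= pairings a b c d.
Proof. by rewrite /pairings -!natrD ler0n. Qed.

Lemma kernel_bounded_pairings I : kernel_bounded (@pairings I) 3.
Proof.
have -> : (3 : R) = 1 + 1 + 1 by ring.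
apply: kernel_boundedD; first apply: kernel_boundedD.
- exact: kernel_bounded_pairing.
(* The other two pairings are the first one with its arguments permuted. *)
- move=> f1 f2 f3 f4; rewrite [_ * l2norm f2]mulrC -[_ * l2norm f3]mulrA.
  rewrite [_ * (_ * l2norm f3)]mulrC.
  apply: le_trans (kernel_bounded_pairing f1 f3 f2 f4); apply: le_of_eq.
  rewrite /kernel_form (reindex (fun p : I * I * I * I =>
    (p.1.1.1, p.1.2, p.1.1.2, p.2))); last first.
    by apply: onW_bij; exists (fun p : I * I * I * I => (p.1.1.1, p.1.2, p.1.1.2, p.2));
      do 3![case].
  by apply: eq_bigr => p _ /=; congr (_ * _); ring.
- move=> f1 f2 f3 f4.
  have -> : l2norm f1 * l2norm f2 * l2norm f3 * l2norm f4 =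
    l2norm f1 * l2norm f4 * l2norm f2 * l2norm f3 by ring.
  apply: le_trans (kernel_bounded_pairing f1 f4 f2 f3); apply: le_of_eq.
  rewrite /kernel_form (reindex (fun p : I * I * I * I =>
    (p.1.1.1, p.1.2, p.2, p.1.1.2))); last first.
    by apply: onW_bij; exists (fun p : I * I * I * I => (p.1.1.1, p.2, p.1.1.2, p.1.2));
      do 3![case].
  by apply: eq_bigr => p _ /=; congr (_ * _); ring.
Qed.

End l2norm.

(** * Splitting off the leading digit of a multi-index *)

Section digits.
Variables (q : nat) (n : 'I_q.+1 -> nat).
Let n0 := n ord0.
Let n1 := (\prod_k n (lift ord0 k))%N.

Definition digit_cons (x : 'I_n0 * 'I_n1) : 'I_(\prod_k n k)%N :=
  cast_ord (esym (big_ord_recl _ _)) (mxtens_index x).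

Lemma digit_cons_bij : bijective digit_cons.
Proof.
exists (fun i => mxtens_unindex (cast_ord (big_ord_recl _ _) i)) => i.
  by rewrite /digit_cons cast_ordKV mxtens_indexK.
by rewrite /digit_cons mxtens_unindexK cast_ordK.
Qed.

Lemma digit_cons0 x : digit (digit_cons x) ord0 = x.1.
Proof.
apply: val_inj; rewrite [LHS]digit0 /=.
by rewrite -[in RHS](mxtens_indexK x).
Qed.

Lemma digit_consS x k : digit (digit_cons x) (lift ord0 k) = digit x.2 k.
Proof. by apply: digitS => /=; rewrite -[in LHS](mxtens_indexK x). Qed.

End digits.

Lemma digit_inj (q : nat) (n : 'I_q -> nat) (i j : 'I_(\prod_k n k)%N) :
  (forall k, digit i k = digit j k) -> i = j.
Proof.
elim: q n i j => [|q IH] n i j H.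
  have E : (\prod_(k < 0) n k = 1)%N by rewrite big_ord0.
  have I0 (l : 'I_(\prod_(k < 0) n k)%N) : val l = 0%N.
    by apply/eqP; rewrite -leqn0 -ltnS -[X in (_ < X)%N]E ltn_ord.
  by apply: val_inj; rewrite !I0.
have [g gK Kg] := digit_cons_bij n.
move: H; rewrite -(Kg i) -(Kg j); case: (g i) (g j) => [a u] [c v] H.
congr (digit_cons (_, _)); first by have := H ord0; rewrite !digit_cons0.
by apply: IH => k; have := H (lift ord0 k); rewrite !digit_consS.
Qed.

(** Induction on [q]: peeling off the leading digit exhibits the kernel as a tensor product, so each
    digit contributes a factor 3. *)
Lemma kernel_bounded_digits (R : rcfType) (q : nat) (n : 'I_q -> nat) :
  kernel_bounded (fun a b c d : 'I_(\prod_k n k)%N =>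
    \prod_k pairings R (digit a k) (digit b k) (digit c k) (digit d k)) (3 ^+ q).
Proof.
elim: q n => [|q IH] n.
  (* Without digits there is a single index, at which the empty product and the pairing indicator
     are both 1. *)
  apply: kernel_bounded_ext (@kernel_bounded_pairing _ _) => a b c d.
  have eqI (i j : 'I_(\prod_(k < 0) n k)%N) : i = j by apply: digit_inj => -[].
  by rewrite [RHS]big_ord0 (eqI a b) (eqI c d) !eqxx.
apply: (kernel_bounded_bij (digit_cons_bij n)).
have W0 (a b c d : 'I_(\prod_k n (lift ord0 k))%N) :
    0 <= \prod_k pairings R (digit a k) (digit b k) (digit c k) (digit d k).
  by apply: prodr_ge0 => k _; exact: pairings_ge0.
rewrite exprS; apply: kernel_bounded_ext (kernel_bounded_tensor W0 (ler0n _ 3)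
  (@kernel_bounded_pairings R 'I_(n ord0)) (IH _)) => a b c d /=.
rewrite [RHS]big_ord_recl !digit_cons0; congr (_ * _).
by apply: eq_bigr => k _; rewrite !digit_consS.
Qed.

(** * Expectations under a finite product law *)

Section product_law.
Variables (R : comPzRingType) (I : finType) (V : I -> finType).
Variable p : forall i, V i -> R.
Implicit Types (v : {dffun forall i, V i}) (G : {dffun forall i, V i} -> R).

Definition update v i (x : V i) : {dffun forall i, V i} :=
  [ffun j => dfwith v i x j].

Definition weight v : R := \prod_i p (v i).

Definition mean G : R := \sum_v weight v * G v.

Lemma update_in v i (x : V i) : update v x i = x.
Proof. by rewrite ffunE dfwithin. Qed.

Lemma update_out v i (x : V i) j : i != j -> update v x j = v j.
Proof. by move=> ij; rewrite ffunE dfwithout. Qed.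

Lemma update_updateK v i (x : V i) : update (update v x) (v i) = v.
Proof.
apply/ffunP => j; have [<-|ij] := eqVneq i j; first by rewrite update_in.
by rewrite !update_out.
Qed.

(** Both sides are the product over the coordinates other than [i], times [p x * p (v i)].
    Cross-multiplying avoids division by a mass that may be 0. *)
Lemma weight_update v i (x : V i) :
  weight (update v x) * p (v i) = weight v * p x.
Proof.
rewrite /weight (bigD1 i)//= [in RHS](bigD1 i)//= update_in.
rewrite mulrAC [in RHS]mulrAC mulrC [in RHS]mulrC [p x * _]mulrC; congr (_ * _).
by apply: eq_bigr => j ij; rewrite update_out// eq_sym.
Qed.

(* (v, x) |-> (update v x, v i) is a weight-preserving involution. *)
Lemma mean_update i G : \sum_(x : V i) p x = 1 ->
  mean G = mean (fun v => \sum_(x : V i) p x * G (update v x)).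
Proof.
move=> p1; rewrite /mean; under [RHS]eq_bigr do rewrite mulr_sumr.
rewrite [RHS]pair_bigA /=.
rewrite [RHS](reindex (fun r : {dffun forall i, V i} * V i => (update r.1 r.2, r.1 i)));
  last first.
  apply: onW_bij; exists (fun r : {dffun forall i, V i} * V i => (update r.1 r.2, r.1 i));
  by case=> v x /=; rewrite update_updateK update_in.
under [RHS]eq_bigr do rewrite /= mulrA weight_update update_updateK.
rewrite -(pair_bigA _ (fun v x => weight v * p x * G v)) /=.
by apply: eq_bigr => v _; rewrite -mulr_suml -mulr_sumr p1 mulr1.
Qed.

(** Resampling coordinate [i] leaves [G] unchanged and averages [g]: expectation is multiplicative
    on independent factors. *)
Lemma mean_mul_coord i G (g : V i -> R) : \sum_(x : V i) p x = 1 ->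
  (forall v (x : V i), G (update v x) = G v) ->
  mean (fun v => G v * g (v i)) = mean G * \sum_x p x * g x.
Proof.
move=> p1 GE; rewrite (mean_update _ p1) mulr_suml; apply: eq_bigr => v _.
rewrite -mulrA; congr (_ * _); rewrite mulr_sumr; apply: eq_bigr => x _.
by rewrite GE update_in mulrCA.
Qed.

Lemma mean_mul_prod_coord (K : finType) (f : K -> I) G
    (g : forall k, V (f k) -> R) :
  injective f -> (forall k, \sum_(x : V (f k)) p x = 1) ->
  (forall k v (x : V (f k)), G (update v x) = G v) ->
  mean (fun v => G v * \prod_k g k (v (f k))) =
  mean G * \prod_k \sum_x p x * g k x.
Proof.
move=> finj p1 GE; move: (index_enum_uniq K).
elim: (index_enum K) => [|k r IH] /=.
  by move=> _; rewrite big_nil mulr1; apply: eq_bigr => v _; rewrite big_nil mulr1.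
case/andP=> kr ur; rewrite big_cons [_ * \prod_(_ <- r) _]mulrC mulrA -IH//.
rewrite -mean_mul_coord//.
  by apply: eq_bigr => v _; rewrite big_cons [g k _ * _]mulrC !mulrA.
(* As [f] is injective and [k] does not occur in [r], the remaining factors ignore coordinate
   [f k]. *)
move=> v x; rewrite GE; congr (_ * _); rewrite [LHS]big_seq [RHS]big_seq.
apply: eq_bigr => l lr; rewrite update_out//; apply: contraNneq kr => /finj ->.
exact: lr.
Qed.

End product_law.

(** * Laws of finite random elements *)

Section joint_law.
Variables (R : realType) (disp : measure_display) (T : measurableType disp).
Variable P : probability T R.

Definition pmass (V : finType) (X : T -> V) (x : V) : R := fine (P (X @^-1` [set x])).

Lemma pmass_ge0 (V : finType) (X : T -> V) x : 0 <= pmass X x.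
Proof. by rewrite fine_ge0. Qed.

Lemma probability_pmass (V : finType) (X : T -> V) (Q : pred V) :
  finite_random_element X ->
  P [set w | Q (X w)] = (\sum_(x | Q x) pmass X x)%:E.
Proof.
move=> mX.
have -> : [set w | Q (X w)] = \bigcup_(x in [set` Q]) (X @^-1` [set x]).
  by apply/seteqP; split=> [w Qw|w [x Qx /= ->]//]; exists (X w).
rewrite measure_fin_bigcup//; last first.
  by move=> x y _ _ [w [] /=] <-.
rewrite -(@bigfs _ _ _ _ (index_enum V)) ?index_enum_uniq//; last first.
  by move=> x _; rewrite mem_index_enum.
rewrite -sumEFin; apply: eq_bigr => x _; rewrite fineK//.
exact: fin_num_measure.
Qed.

Lemma sum_pmass (V : finType) (X : T -> V) : finite_random_element X ->
  \sum_x pmass X x = 1.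
Proof.
move=> mX; apply: EFin_inj; rewrite -(probability_pmass xpredT mX) -(probability_setT P).
by congr (P _); apply/seteqP; split.
Qed.

Variables (I : finType) (V : I -> finType) (X : forall i, T -> V i).
Hypothesis mX : forall i, finite_random_element (X i).
Hypothesis indepX : mutually_independent P X.

(** Gathering all coordinates in one element of a finite type turns probabilities into finite sums
    of [weight]. *)
Definition joint (w : T) : {dffun forall i, V i} := [ffun i => X i w].

Lemma joint_preimage1 (v : {dffun forall i, V i}) :
  joint @^-1` [set v] = \bigcap_(i in [set` [set: I]%SET]) (X i @^-1` [set v i]).
Proof.
apply/seteqP; split=> [w /= <- i _|w H] /=; first by rewrite ffunE.
by apply/ffunP => i; rewrite ffunE; apply: H; rewrite /= inE.
Qed.

Lemma finite_random_element_joint : finite_random_element joint.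
Proof.
move=> B.
have -> : joint @^-1` B = \bigcup_(v in B) (joint @^-1` [set v]).
  by apply/seteqP; split=> [w Bw|w [v Bv /= ->]//]; exists (joint w).
apply: fin_bigcup_measurable => // v _; rewrite joint_preimage1.
apply: fin_bigcap_measurable => // i _; exact: mX.
Qed.

(** Mutual independence at the full index set factors the mass of each point. *)
Lemma pmass_joint v : pmass joint v = weight (fun i => pmass (X i)) v.
Proof.
rewrite /pmass joint_preimage1 indepX.
rewrite (eq_bigr (fun i => (pmass (X i) (v i))%:E)); last first.
  by move=> i _; rewrite fineK// fin_num_measure//; exact: mX.
by rewrite prodEFin /weight; apply: eq_bigl => i; rewrite inE.
Qed.

Lemma sum_weight_pmass : \sum_v weight (fun i => pmass (X i)) v = 1.
Proof.
rewrite -(sum_pmass finite_random_element_joint).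
by apply: eq_bigr => v _; rewrite pmass_joint.
Qed.

End joint_law.

Section kwise.
Variables (R : realType) (disp : measure_display) (T : measurableType disp).
Variable P : probability T R.

Lemma kwise_independent_pmass (k : nat) (D V : finType) (f : T -> {ffun D -> V})
    (J : {set D}) (v : D -> V) :
  finite_random_element f -> kwise_independent P k f -> (#|J| <= k)%N ->
  \sum_(x : {ffun D -> V} | [forall a in J, x a == v a]) pmass P f x =
  #|V|%:R^-1 ^+ #|J|.
Proof.
move=> mf kf Jk; apply: EFin_inj.
rewrite -(probability_pmass P [pred x : {ffun D -> V} | [forall a in J, x a == v a]] mf).
rewrite -(kf J v Jk); congr (P _); apply/seteqP; split=> w /=.
  by move=> /forall_inP H a /H /eqP.
by move=> H; apply/forall_inP => a /H ->.
Qed.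

End kwise.

(** * Moments of 4-wise independent signs *)

Section sign_moments.
Variables (R : realType) (D : finType) (p : {ffun D -> bool} -> R).
Hypothesis p_ge0 : forall x, 0 <= p x.
Hypothesis sum_p : \sum_x p x = 1.
Hypothesis p4 : forall (J : {set D}) (v : D -> bool), (#|J| <= 4)%N ->
  \sum_(x : {ffun D -> bool} | [forall a in J, x a == v a]) p x = 2^-1 ^+ #|J|.

Definition flip (t : D) (x : {ffun D -> bool}) : {ffun D -> bool} :=
  [ffun a => x a (+) (a == t)].

Lemma flipK t : involutive (flip t).
Proof. by move=> x; apply/ffunP => a; rewrite !ffunE -addbA addbb addbF. Qed.

Lemma mean_odd_eq0 (J : {set D}) (t : D) (F : {ffun D -> bool} -> R) :
  (#|J| <= 4)%N -> t \in J ->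
  (forall x y : {ffun D -> bool}, {in J, x =1 y} -> F x = F y) ->
  (forall x, F (flip t x) = - F x) ->
  \sum_x p x * F x = 0.
Proof.
move=> J4 tJ FJ Fflip.
(* The restriction of a random x to J, extended by false, is uniform; flipping t
   then cancels the terms in pairs. *)
pose rho (x : {ffun D -> bool}) := [ffun a => (a \in J) && x a] : {ffun D -> bool}.
have rhoJ x : {in J, rho x =1 x} by move=> a aJ; rewrite ffunE aJ.
have rhoK x : rho (rho x) = rho x.
  by apply/ffunP => a; rewrite !ffunE; case: (a \in J).
have rhoE x v : rho v = v -> (rho x == v) = [forall a in J, x a == v a].
  move=> vE; apply/eqP/forall_inP => [<- a aJ|H]; first by rewrite rhoJ.
  rewrite -vE; apply/ffunP => a; rewrite !ffunE.
  by have [/H /eqP ->|] := boolP (a \in J).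
pose S := \sum_(v | rho v == v) F v.
have S0 : S = 0.
  (* Flipping [t] permutes the fixed points of [rho], because [t] lies in [J]. *)
  have SN : S = - S.
    rewrite {1}/S (reindex_inj (can_inj (flipK t))) -sumrN; apply: eq_big => v.
      apply/eqP/eqP => H; apply/ffunP => a; move/ffunP/(_ a): H; rewrite !ffunE.
        by case: eqVneq => [->|]; rewrite ?tJ ?addbF.
      by case: eqVneq => [->|]; rewrite ?tJ ?addbF.
    by move=> _; rewrite Fflip.
  by lra.
rewrite (partition_big rho (fun v => rho v == v)); last first.
  by move=> x _; rewrite rhoK.
(* Every fibre of [rho] has mass [2^-1 ^+ #|J|], and [F] is constant on it. *)
transitivity (2^-1 ^+ #|J| * S); last by rewrite S0 mulr0.
rewrite mulr_sumr; apply: eq_bigr => v /eqP vE.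
rewrite -(p4 v J4) mulr_suml; apply: eq_big => [x|x /eqP xv]; first exact: rhoE.
by congr (_ * _); apply: FJ => a aJ; rewrite -xv rhoJ.
Qed.

Definition sgn (x : {ffun D -> bool}) (a : D) : R := (-1) ^+ x a.

Lemma sgn_flip_in t x : sgn (flip t x) t = - sgn x t.
Proof. by rewrite /sgn ffunE eqxx addbT; case: (x t); rewrite ?expr1 ?expr0 ?opprK. Qed.

Lemma sgn_flip_out t x a : t != a -> sgn (flip t x) a = sgn x a.
Proof. by move=> ta; rewrite /sgn ffunE eq_sym (negbTE ta) addbF. Qed.

(** The points [y1], [y2], [y3] may coincide with one another. The product depends on at most four
    values and changes sign when the one at [t] is flipped. *)
Lemma mean_sgn4_eq0 (t y1 y2 y3 : D) : t != y1 -> t != y2 -> t != y3 ->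
  \sum_x p x * (sgn x t * sgn x y1 * sgn x y2 * sgn x y3) = 0.
Proof.
move=> t1 t2 t3; apply: (@mean_odd_eq0 [set t; y1; y2; y3] t).
- have c1 (A : {set D}) y k : (#|A| <= k -> #|A :|: [set y]| <= k.+1)%N.
    by move=> Ak; rewrite finset.setUC cardsU1 -add1n leq_add ?leq_b1.
  by do 3!apply: (c1 _ _ _); rewrite cards1.
- by rewrite !inE eqxx.
- by move=> x y xy; rewrite /sgn !xy ?inE ?eqxx ?orbT.
- by move=> x; rewrite sgn_flip_in !sgn_flip_out// !mulNr.
Qed.

Lemma norm_sgn x a : `|sgn x a| = 1.
Proof. by rewrite /sgn normrX normrN1 expr1n. Qed.

(* Unless a, b, c, d agree in pairs, one of them differs from the other three. *)
Lemma norm_mean_sgn4_le (a b c d : D) :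
  `|\sum_x p x * (sgn x a * sgn x b * sgn x c * sgn x d)| <= pairings R a b c d.
Proof.
have le1 : `|\sum_x p x * (sgn x a * sgn x b * sgn x c * sgn x d)| <= 1.
  rewrite -sum_p; apply: le_trans (ler_norm_sum _ _ _) _; apply: ler_sum => x _.
  by rewrite !normrM !norm_sgn !mulr1 ger0_norm.
have [/or3P ab|] := boolP [|| (a == b) && (c == d), (a == c) && (b == d) |
                           (a == d) && (b == c)].
  apply: le_trans le1 _; rewrite /pairings -!natrD (ler_nat R 1).
  by case: ab => ->; rewrite ?addn1 ?addnS ?addSn.
rewrite !negb_or => /and3P[abcd acbd adbc].
suff -> : \sum_x p x * (sgn x a * sgn x b * sgn x c * sgn x d) = 0.
  by rewrite normr0 pairings_ge0.
have sgnE t y1 y2 y3 : t != y1 -> t != y2 -> t != y3 ->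
    (forall x, sgn x a * sgn x b * sgn x c * sgn x d =
               sgn x t * sgn x y1 * sgn x y2 * sgn x y3) ->
    \sum_x p x * (sgn x a * sgn x b * sgn x c * sgn x d) = 0.
  by move=> t1 t2 t3 E; under eq_bigr do rewrite E; exact: mean_sgn4_eq0.
(* Locating an isolated point: if [a = b], it is [d] or [c] according to whether [b = c]; otherwise
   it is [b] if [a] equals [c] or [d], and [a] itself if not. *)
have [ab|ab] := eqVneq a b.
  have cd := abcd; rewrite (introT eqP ab) /= in cd; have [bc|bc] := eqVneq b c.
    by apply: (sgnE d a b c); rewrite ?ab ?bc// 1?eq_sym// => x; ring.
  by apply: (sgnE c a b d); rewrite ?ab// 1?eq_sym// => x; ring.
have [ac|ac] := eqVneq a c.
  have bd := acbd; rewrite (introT eqP ac) /= in bd.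
  by apply: (sgnE b a c d); rewrite -?ac// 1?eq_sym// => x; ring.
have [ad|ad] := eqVneq a d; last exact: mean_sgn4_eq0.
have bc := adbc; rewrite (introT eqP ad) /= in bc.
by apply: (sgnE b a c d); rewrite -?ad// 1?eq_sym// => x; ring.
Qed.

End sign_moments.

(** * Collision probability of a hash function with offsets *)

Section hash_collision.
Variables (R : realType) (D : finType) (m : nat) (p : {ffun D -> 'I_m} -> R).
Hypothesis p_ge0 : forall x, 0 <= p x.
Hypothesis p2 : forall (J : {set D}) (v : D -> 'I_m), (#|J| <= 2)%N ->
  \sum_(x : {ffun D -> 'I_m} | [forall a in J, x a == v a]) p x = m%:R^-1 ^+ #|J|.

(** Given the value at [b], the congruence allows at most one value at [a], so the event is covered
    by [m] events of mass [m^-2]. The offsets stand for the hashes of the remaining digits. *)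
Lemma hash_collision_le (a b : D) (A B : nat) : a != b ->
  \sum_(x : {ffun D -> 'I_m} | x a + A == x b + B %[mod m]) p x <= m%:R^-1.
Proof.
move=> ab.
have [m0|m0] := posnP m.
  (* For [m = 0] the sum is empty: a function would need a value at [a] in an empty type. *)
  rewrite big_pred0 ?invr_ge0// => x.
  by have := leq_ltn_trans (leq0n _) (ltn_ord (x a)); rewrite [X in (_ < X)%N]m0.
rewrite (partition_big (fun x : {ffun D -> 'I_m} => x b) xpredT)//=.
apply: (@le_trans _ _ (\sum_(w < m) m%:R^-1 ^+ 2)); last first.
  rewrite sumr_const card_ord expr2 -[(_ * _) *+ _]mulr_natr -mulrA mulVf ?mulr1//.
  by rewrite pnatr_eq0 -lt0n.
apply: ler_sum => w _.
have [u /eqP uE|uN] := pickP (fun u : 'I_m => u + A == w + B %[mod m]); last first.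
  rewrite big_pred0 ?exprn_ge0 ?invr_ge0// => x; apply/negP => /andP[xE /eqP xb].
  by have := uN (x a); rewrite -xb xE.
have J2 : #|[set a; b]%SET| = 2%N by rewrite cards2 ab.
have := p2 (fun e => if e == a then u else w) (eq_leq J2); rewrite J2 => <-.
rewrite [leRHS](bigID (fun x : {ffun D -> 'I_m} =>
  (x a + A == x b + B %[mod m]) && (x b == w))) /= -[leLHS]addr0 lerD//; last first.
  exact: sumr_ge0.
apply: le_of_eq; apply: eq_bigl => x.
have [/andP[xE /eqP xb]|_] := boolP (_ && _); last by rewrite andbF.
rewrite andbT; apply/esym/forall_inP => e; rewrite !inE => /orP[]/eqP ->.
  by rewrite eqxx; move: xE; rewrite xb -uE eqn_modDr !modn_small.
by rewrite [b == a]eq_sym (negbTE ab) xb.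
Qed.

End hash_collision.

(** * Second moments of the Gram error of the sketch *)

Section sketch_moments.
Variables (R : realType) (q m : nat) (n : 'I_q -> nat).
Hypothesis m_gt0 : (0 < m)%N.
Notation seeds := {dffun forall i : 'I_q + 'I_q, seed_type m n i}.
Notation index := 'I_(\prod_k n k)%N.
Implicit Types (v : seeds) (c e : index).

Definition hash_of v k : {ffun 'I_(n k) -> 'I_m} := v (inl k).
Definition sign_of v k : {ffun 'I_(n k) -> bool} := v (inr k).
Definition sketch_of v : 'M[R]_(m, (\prod_k n k)%N) :=
  tensor_sketch_mx R (hash_of v) (sign_of v).

Definition hash_sum v c : nat := (\sum_k hash_of v k (digit c k))%N.
Definition collide v c e : bool := hash_sum v c == hash_sum v e %[mod m].
Definition gram_error v : 'M[R]_(\prod_k n k)%N :=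
  (sketch_of v)^T *m sketch_of v - 1%:M.

(** Only the row hit by column [c] can contribute to the inner product of the two columns. *)
Lemma sketch_gramE v c e : ((sketch_of v)^T *m sketch_of v) c e =
  (collide v c e)%:R *
  \prod_k (sgn R (sign_of v k) (digit c k) * sgn R (sign_of v k) (digit e k)).
Proof.
rewrite mxE (bigD1 (Ordinal (ltn_pmod (hash_sum v c) m_gt0)))//= [X in _ + X]big1 ?addr0.
  rewrite !mxE eqxx /collide /hash_sum big_split /=.
  by case: ifP => _; rewrite ?mulr0 ?mul0r ?mul1r.
move=> r rc; rewrite !mxE; case: ifP => [/eqP rE|]; last by rewrite mul0r.
by move: rc; rewrite -val_eqE /= rE eqxx.
Qed.

(** On the diagonal, an index collides with itself and its signs square to 1, which the identity
    matrix cancels. *)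
Lemma gram_errorE v c e : gram_error v c e = (c != e)%:R * ((collide v c e)%:R *
  \prod_k (sgn R (sign_of v k) (digit c k) * sgn R (sign_of v k) (digit e k))).
Proof.
rewrite mxE sketch_gramE [in LHS]mxE [in LHS]mxE; have [->|ce] /= := eqVneq c e.
  rewrite /collide eqxx mul1r mul0r big1 ?subrr// => k _.
  by rewrite -expr2 sqrr_sign.
by rewrite subr0 mul1r.
Qed.

Variable p : forall i, seed_type m n i -> R.
Hypothesis p_ge0 : forall i (x : seed_type m n i), 0 <= p x.
Hypothesis sum_p : forall i, \sum_(x : seed_type m n i) p x = 1.
Hypothesis sum_weight : \sum_v weight p v = 1.
Hypothesis hash2 : forall k (J : {set 'I_(n k)}) (v : 'I_(n k) -> 'I_m),
  (#|J| <= 2)%N ->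
  \sum_(x : {ffun 'I_(n k) -> 'I_m} | [forall a in J, x a == v a]) @p (inl k) x =
  m%:R^-1 ^+ #|J|.
Hypothesis sign4 : forall k (J : {set 'I_(n k)}) (v : 'I_(n k) -> bool),
  (#|J| <= 4)%N ->
  \sum_(x : {ffun 'I_(n k) -> bool} | [forall a in J, x a == v a]) @p (inr k) x =
  2^-1 ^+ #|J|.

Lemma weight_ge0 v : 0 <= weight p v.
Proof. by apply: prodr_ge0 => i _; exact: p_ge0. Qed.

Lemma norm_mean_le (G : seeds -> R) : `|mean p G| <= mean p (fun v => `|G v|).
Proof.
apply: le_trans (ler_norm_sum _ _ _) _; apply: ler_sum => v _.
by rewrite normrM ger0_norm ?weight_ge0.
Qed.

Lemma mean_le (F G : seeds -> R) : (forall v, F v <= G v) -> mean p F <= mean p G.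
Proof. by move=> FG; apply: ler_sum => v _; rewrite ler_wpM2l ?weight_ge0. Qed.

(** Distinct indices differ at some digit [k]. Resampling only the [k]-th hash turns the other
    hashes into fixed offsets. *)
Lemma mean_collide_le c e : c != e -> mean p (fun v => (collide v c e)%:R) <= m%:R^-1.
Proof.
move=> ce; have [k kE] : exists k, digit c k != digit e k.
  apply/existsP; apply: contraR ce; rewrite negb_exists => /forallP H.
  by apply/eqP/digit_inj => k; apply/eqP; move: (H k); rewrite negbK.
rewrite (mean_update _ (sum_p (inl k))).
apply: (@le_trans _ _ (mean p (fun=> m%:R^-1))); last first.
  by rewrite /mean -mulr_suml sum_weight mul1r.
apply: mean_le => v.
pose rest a := (\sum_(l | l != k) hash_of v l (digit a l))%N.
have sumE (x : {ffun 'I_(n k) -> 'I_m}) a :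
    hash_sum (@update _ _ v (inl k) x) a = (x (digit a k) + rest a)%N.
  rewrite /hash_sum (bigD1 k)//= /hash_of update_in; congr (_ + _)%N.
  by apply: eq_bigr => l lk; rewrite update_out//; apply: contraNneq lk => -[->].
have := @hash_collision_le R _ m (@p (inl k)) (@p_ge0 (inl k)) (@hash2 k) _ _
  (rest c) (rest e) kE.
apply: le_trans; rewrite [leRHS]big_mkcond; apply: ler_sum => x _.
by rewrite /collide !sumE; case: ifP; rewrite ?mulr1 ?mulr0.
Qed.

(** Collisions depend only on the hashes, so the expectation splits into a joint collision
    probability and, for each digit, a fourth moment of signs. *)
Lemma norm_mean_gram_error2_le (c1 c2 c3 c4 : index) :
  `|mean p (fun v => gram_error v c1 c2 * gram_error v c3 c4)| <=
  m%:R^-1 * \prod_k pairings R (digit c1 k) (digit c2 k) (digit c3 k) (digit c4 k).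
Proof.
have rhs0 : 0 <= m%:R^-1 *
    \prod_k pairings R (digit c1 k) (digit c2 k) (digit c3 k) (digit c4 k).
  by rewrite mulr_ge0 ?invr_ge0//; apply: prodr_ge0 => k _; exact: pairings_ge0.
have [c12|c12] := eqVneq c1 c2.
  rewrite /mean big1 ?normr0// => v _.
  by rewrite gram_errorE c12 eqxx !mul0r mulr0.
have [c34|c34] := eqVneq c3 c4.
  rewrite /mean big1 ?normr0// => v _.
  by rewrite (gram_errorE v c3) c34 eqxx mul0r !mulr0.
pose g k (s : {ffun 'I_(n k) -> bool}) := sgn R s (digit c1 k) *
  sgn R s (digit c2 k) * sgn R s (digit c3 k) * sgn R s (digit c4 k).
have -> : mean p (fun v => gram_error v c1 c2 * gram_error v c3 c4) =
    mean p (fun v => (collide v c1 c2 && collide v c3 c4)%:R) *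
    \prod_k \sum_(s : {ffun 'I_(n k) -> bool}) @p (inr k) s * g k s.
  rewrite -(@mean_mul_prod_coord _ _ _ p _ inr _ g)//.
  - apply: eq_bigr => v _; congr (_ * _); rewrite !gram_errorE c12 c34 !mul1r.
    rewrite mulrACA -natrM mulnb -big_split /=; congr (_ * _).
    by apply: eq_bigr => k _; rewrite /g !mulrA.
  - by move=> k l [->].
  move=> k v s; suff hE c : hash_sum (update v s) c = hash_sum v c.
    by rewrite /collide !hE.
  by apply: eq_bigr => l _; rewrite /hash_of update_out.
rewrite normrM ler_pM//.
  (* The second collision is dropped; the first alone already has probability at most [1 / m]. *)
  apply: le_trans (norm_mean_le _) _; apply: le_trans (mean_collide_le c12).
  apply: mean_le => v; rewrite normr_nat ler_nat.
  by case: (collide v c1 c2); case: (collide v c3 c4).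
rewrite normr_prod; apply: ler_prod => k _; rewrite normr_ge0 /=.
exact: (norm_mean_sgn4_le (@p_ge0 (inr k)) (sum_p (inr k)) (@sign4 k)).
Qed.

Definition error_form v (x y : 'cV[R]_(\prod_k n k)%N) : R :=
  \sum_c \sum_e gram_error v c e * (x c 0 * y e 0).

Lemma mean_sqr_error_form_le (x y : 'cV[R]_(\prod_k n k)%N) :
  mean p (fun v => error_form v x y ^+ 2) <=
  3 ^+ q / m%:R * (norm2 x ^+ 2 * norm2 y ^+ 2).
Proof.
(* The entrywise bound concerns absolute values, so the kernel estimate is applied to those of [x]
   and [y], which have the same norms. *)
pose f c := `|x c 0|; pose g c := `|y c 0|.
have -> : mean p (fun v => error_form v x y ^+ 2) =
    \sum_(r : index * index * index * index)
      mean p (fun v => gram_error v r.1.1.1 r.1.1.2 * gram_error v r.1.2 r.2) *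
      (x r.1.1.1 0 * y r.1.1.2 0 * x r.1.2 0 * y r.2 0).
  under [RHS]eq_bigr do rewrite mulr_suml.
  rewrite exchange_big /=; apply: eq_bigr => v _.
  under [RHS]eq_bigr do rewrite -mulrA.
  rewrite -mulr_sumr; congr (_ * _).
  rewrite expr2 /error_form pair_bigA /= big_distrlr /= pair_bigA /=.
  rewrite (reindex (fun r : index * index * index * index =>
    (r.1.1, (r.1.2, r.2)))); last first.
    apply: onW_bij; exists (fun r : (index * index) * (index * index) =>
      (r.1, r.2.1, r.2.2)); first by do 3!case.
    by case=> -[a b] [c e].
  by apply: eq_bigr => r _ /=; ring.
apply: (@le_trans _ _ (m%:R^-1 * kernel_form (fun a b c d : index =>
    \prod_k pairings R (digit a k) (digit b k) (digit c k) (digit d k)) f g f g)).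
  rewrite mulr_sumr; apply: ler_sum => r _; rewrite [leRHS]mulrA.
  apply: le_trans (ler_norm _) _; rewrite !normrM.
  apply: ler_wpM2r; first by rewrite !mulr_ge0.
  exact: norm_mean_gram_error2_le.
rewrite mulrAC [leRHS]mulrC; apply: ler_wpM2l; first by rewrite invr_ge0.
apply: le_trans (kernel_bounded_digits _ _ _ _) _; rewrite !l2norm_abs.
by apply: le_of_eq; congr (_ * _); rewrite /norm2 -/(l2norm _) -/(l2norm _); ring.
Qed.

(** Markov's inequality for the complement: where [F v] exceeds [t], the weight is at most
    [weight p v * F v / t]. *)
Lemma markov_weight (F : seeds -> R) (t : R) : (forall v, 0 <= F v) -> 0 < t ->
  1 - mean p F / t <= \sum_(v | F v <= t) weight p v.
Proof.
move=> F0 t0; rewrite -sum_weight (bigID (fun v => F v <= t)) /= lerBlDr.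
rewrite lerD2l ler_pdivlMr// mulr_suml /mean [leRHS](bigID (fun v => F v <= t)) /=.
rewrite -[leLHS]add0r lerD//.
  by apply: sumr_ge0 => v _; rewrite mulr_ge0 ?weight_ge0.
by apply: ler_sum => v; rewrite -ltNge => /ltW tF; rewrite ler_wpM2l ?weight_ge0.
Qed.

End sketch_moments.

(** * Deterministic analysis of sketched least squares *)

Section least_squares.
Variable R : realType.

Lemma sqr_norm2 N (v : 'cV[R]_N) : norm2 v ^+ 2 = (v^T *m v) 0 0.
Proof.
rewrite sqr_sqrtr ?sum_sqr_ge0//.
by rewrite mxE; apply: eq_bigr => i _; rewrite mxE expr2.
Qed.

Lemma norm2_ge0 N (v : 'cV[R]_N) : 0 <= norm2 v.
Proof. exact: sqrtr_ge0. Qed.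

Lemma norm2_eq0 N (v : 'cV[R]_N) : norm2 v = 0 -> v = 0.
Proof.
move=> v0; have /eqP := sqr_l2norm (fun i => v i 0).
rewrite [l2norm _]v0 expr0n /= eq_sym psumr_eq0; last by move=> i _; exact: sqr_ge0.
move=> /allP H; apply/matrixP => i j; rewrite ord1 mxE.
by have := H i (mem_index_enum i); rewrite /= sqrf_eq0 => /eqP.
Qed.

(** Gram-Schmidt, starting from the last column. A column with zero residual adds no basis vector,
    so [r] may be smaller than [k]. *)
Lemma exists_orthonormal_span N k (B : 'M[R]_(N, k)) :
  exists r (U : 'M[R]_(N, r)) (C : 'M[R]_(r, k)),
    [/\ (r <= k)%N, U^T *m U = 1%:M & B = U *m C].
Proof.
elim: k B => [|k IH] B.
  by exists 0%N, 0, 0; split=> //; [rewrite !flatmx0|rewrite !thinmx0].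
suff H (b : 'cV[R]_N) (B' : 'M[R]_(N, k)) :
    exists r (U : 'M[R]_(N, r)) (C : 'M[R]_(r, 1 + k)),
      [/\ (r <= k.+1)%N, U^T *m U = 1%:M & row_mx b B' = U *m C].
  by rewrite -[B](@hsubmxK _ _ 1 k); exact: H.
have [r [U [C [rk UU ->]]]] := IH B'.
pose w := b - U *m (U^T *m b).
have bE : b = U *m (U^T *m b) + w by rewrite addrC subrK.
have Uw : U^T *m w = 0 by rewrite mulmxBr [U^T *m (U *m _)]mulmxA UU mul1mx subrr.
have [w0|w0] := eqVneq (norm2 w) 0.
  exists r, U, (row_mx (U^T *m b) C); split=> //; first exact: leqW.
  by rewrite mul_mx_row {1}bE (norm2_eq0 w0) addr0.
(* Otherwise the normalised residual joins the basis, and [b] has coordinate [norm2 w] along it. *)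
exists (r + 1)%N, (row_mx U ((norm2 w)^-1 *: w)),
  (block_mx (U^T *m b) C (norm2 w)%:M 0); split.
- by rewrite addn1 ltnS.
- rewrite tr_row_mx mul_col_row UU -scalemxAr Uw scaler0 linearZ /= -!scalemxAl.
  have -> : w^T *m U = 0 by rewrite -[U]trmxK -trmx_mul Uw trmx0.
  rewrite scaler0 -scalemxAr [w^T *m w]mx11_scalar -sqr_norm2 scalerA.
  by rewrite scale_scalar_mx -invfM -expr2 mulVf ?expf_neq0// scalar_mx_block.
rewrite mul_row_block mulmx0 addr0 {1}bE; congr (row_mx (_ + _) _).
by rewrite mul_mx_scalar scalerA divff// scale1r.
Qed.

(** Cauchy-Schwarz over index pairs: the form is the inner product of [M] with [z z^T], whose
    Frobenius norm is [norm2 z ^+ 2]. *)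
Lemma norm_quadratic_form_le r (M : 'M[R]_r) (z : 'cV[R]_r) :
  `|(z^T *m M *m z) 0 0| <= Num.sqrt (\sum_i \sum_j M i j ^+ 2) * norm2 z ^+ 2.
Proof.
have -> : (z^T *m M *m z) 0 0 =
    \sum_(s : 'I_r * 'I_r) M s.1 s.2 * (z s.1 0 * z s.2 0).
  rewrite -mulmxA mxE; under eq_bigr do rewrite !mxE mulr_sumr.
  by rewrite pair_bigA /=; apply: eq_bigr => s _; ring.
apply: le_trans (norm_sum_mul_le _ _) _; apply: le_of_eq; congr (_ * _).
  by rewrite /l2norm -(pair_bigA _ (fun i j => M i j ^+ 2)).
have E : (norm2 z ^+ 2) ^+ 2 = \sum_(s : 'I_r * 'I_r) (z s.1 0 * z s.2 0) ^+ 2.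
  rewrite sqr_norm2 expr2 mxE big_distrlr pair_bigA /=.
  by apply: eq_bigr => s _; rewrite !mxE; ring.
by rewrite /l2norm -E sqrtr_sqr ger0_norm ?sqr_ge0.
Qed.

(** As [U] is an isometry, the distortion is the quadratic form of the compressed Gram error at [z],
    which its Frobenius norm controls. *)
Lemma subspace_embedding m N r (S : 'M[R]_(m, N)) (U : 'M[R]_(N, r))
    (e : R) (z : 'cV[R]_r) :
  U^T *m U = 1%:M -> 0 <= e ->
  \sum_i \sum_j (U^T *m (S^T *m S - 1%:M) *m U) i j ^+ 2 <= e ^+ 2 ->
  `|norm2 (S *m (U *m z)) ^+ 2 - norm2 (U *m z) ^+ 2| <= e * norm2 (U *m z) ^+ 2.
Proof.
move=> UU e0 He.
have zE : norm2 (U *m z) ^+ 2 = norm2 z ^+ 2.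
  by rewrite !sqr_norm2 trmx_mul mulmxA -[z^T *m _ *m U]mulmxA UU mulmx1.
have -> : norm2 (S *m (U *m z)) ^+ 2 - norm2 (U *m z) ^+ 2 =
    (z^T *m (U^T *m (S^T *m S - 1%:M) *m U) *m z) 0 0.
  rewrite zE !sqr_norm2 mulmxBr mulmx1 mulmxBl UU mulmxBr mulmxBl mulmx1.
  rewrite [RHS]mxE [X in _ = _ + X]mxE; congr (_ 0 0 - _).
  by rewrite !trmx_mul !mulmxA.
apply: le_trans (norm_quadratic_form_le _ _) _; rewrite zE ler_wpM2r ?sqr_ge0//.
by rewrite -(ger0_norm e0) -sqrtr_sqr ler_wsqrtr.
Qed.

Lemma sketched_argmin_le m N k r (S : 'M[R]_(m, N)) (A : 'M[R]_(N, k))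
    (b : 'cV[R]_N) (U : 'M[R]_(N, r)) (C : 'M[R]_(r, 1 + k)) (e : R)
    (xt : 'cV[R]_k) :
  row_mx b A = U *m C -> U^T *m U = 1%:M -> 0 < e < 1 ->
  \sum_i \sum_j (U^T *m (S^T *m S - 1%:M) *m U) i j ^+ 2 <= (e / 2) ^+ 2 ->
  lsq_argmin (S *m A) (S *m b) xt ->
  norm2 (A *m xt - b) <= (1 + e) * lsq_min A b.
Proof.
move=> bAE UU /andP[e0 e1] He xtP.
have distortion x : `|norm2 (S *m (A *m x - b)) ^+ 2 - norm2 (A *m x - b) ^+ 2| <=
    e / 2 * norm2 (A *m x - b) ^+ 2.
  (* Every residual lies in the span of [U]: it combines [b] with coefficient -1 and the columns of
     [A] with coefficients [x]. *)
  have -> : A *m x - b = U *m (C *m col_mx (- 1%:M) x).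
    by rewrite mulmxA -bAE mul_row_col mulmxN mulmx1 addrC.
  by apply: subspace_embedding => //; rewrite divr_ge0// ltW.
have le_all y : norm2 (A *m xt - b) <= (1 + e) * norm2 (A *m y - b).
  rewrite -(@ler_pXn2r _ 2) ?nnegrE ?mulr_ge0 ?norm2_ge0//; last by rewrite addr_ge0// ltW.
  have := xtP y; rewrite -!mulmxA -!mulmxBr => Sle.
  have : norm2 (S *m (A *m xt - b)) ^+ 2 <= norm2 (S *m (A *m y - b)) ^+ 2.
    by rewrite ler_pXn2r// ?nnegrE ?norm2_ge0.
  move: (distortion xt) (distortion y); rewrite !ler_norml exprMn.
  have := sqr_ge0 (norm2 (A *m xt - b)); have := sqr_ge0 (norm2 (A *m y - b)).
  (* In squared norms, [(1 - e/2) |A xt - b|^2 <= |S (A xt - b)|^2 <= |S (A y - b)|^2 <= (1 + e/2)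
     |A y - b|^2], and [(1 + e)^2 (1 - e/2) - (1 + e/2) = e - e^3/2] is nonnegative. *)
  move: (_ ^+ 2) (_ ^+ 2) (_ ^+ 2) (_ ^+ 2) => a c a' c' *. nra.
rewrite -ler_pdivrMl ?addr_gt0//; apply: lb_le_inf.
  by exists (norm2 (A *m xt - b)), xt.
by move=> _ [y _ <-]; rewrite ler_pdivrMl ?addr_gt0.
Qed.

End least_squares.

(** * Assembling the probability bound *)

Lemma error_formE (R : realType) (q m : nat) (n : 'I_q -> nat)
    (v : {dffun forall i : 'I_q + 'I_q, seed_type m n i})
    (r : nat) (U : 'M[R]_(\prod_k n k, r)) i j :
  (U^T *m gram_error R v *m U) i j = error_form v (col i U) (col j U).
Proof.
rewrite -mulmxA mxE; apply: eq_bigr => c _; rewrite !mxE mulr_sumr.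
by apply: eq_bigr => e _; rewrite !mxE; ring.
Qed.

Lemma sketch_of_joint (R : realType) (disp : measure_display)
    (T : measurableType disp) (q m : nat) (n : 'I_q -> nat)
    (h : forall k, T -> {ffun 'I_(n k) -> 'I_m})
    (s : forall k, T -> {ffun 'I_(n k) -> bool}) (w : T) :
  tensor_sketch_mx R (fun k => h k w) (fun k => s k w) =
  sketch_of R (joint (seed h s) w).
Proof.
by congr tensor_sketch_mx; apply: functional_extensionality_dep => k;
  rewrite /hash_of /sign_of ffunE.
Qed.

Theorem mainTheorem1 (R : realType) (disp : measure_display)
    (T : measurableType disp) (P : probability T R)
    (q : nat) (n d : 'I_q -> nat) (A : forall k, 'M[R]_(n k, d k))
    (b : 'cV[R]_((\prod_k n k)%N)) (eps delta : R) (m : nat)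
    (S : T -> 'M[R]_(m, (\prod_k n k)%N)) :
  (0 < q)%N ->
  0 < eps < 1 ->
  0 < delta < 1 ->
  m%:Z = Num.ceil (8 * ((\prod_k d k)%:R + 1) ^+ 2 * (2 + 3 ^+ q)
                   / (eps ^+ 2 * delta)) ->
  random_tensor_sketch P S ->
  let good := [set w | forall xt, lsq_argmin (S w *m kron A) (S w *m b) xt ->
                 norm2 (kron A *m xt - b) <= (1 + eps) * lsq_min (kron A) b] in
  measurable good /\ ((1 - delta)%:E <= P good)%E.
Proof.
move=> _ eps01 /andP[delta0 delta1] mE [h [s [mX indepX h3 s4 SE]]] good.
have [eps0 eps1] := andP eps01.
pose X := joint (seed h s).
have mJ : finite_random_element X by exact: finite_random_element_joint.
have SX w : S w = sketch_of R (X w) by rewrite SE sketch_of_joint.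
(* Membership in [good] depends on [w] only through the finite-valued [X], all of whose preimages
   are events. *)
have mgood : measurable good.
  have -> : good = X @^-1` [set v | forall xt,
      lsq_argmin (sketch_of R v *m kron A) (sketch_of R v *m b) xt ->
      norm2 (kron A *m xt - b) <= (1 + eps) * lsq_min (kron A) b].
    by rewrite /good; apply/seteqP; split=> w /=; rewrite SX.
  exact: mJ.
split=> //.
set D : R := (\prod_k d k)%:R in mE.
have D0 : 0 <= D by exact: ler0n.
have q3 : 0 < 3 ^+ q :> R by rewrite exprn_gt0.
have ed0 : 0 < eps ^+ 2 * delta by rewrite mulr_gt0// exprn_gt0.
have m_ge : 8 * (D + 1) ^+ 2 * (2 + 3 ^+ q) <= m%:R * (eps ^+ 2 * delta).
  by rewrite -ler_pdivrMr// -[m%:R]/(m%:Z%:~R) mE ceil_ge.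
have m_gt0 : (0 < m)%N.
  rewrite -(ltr_nat R) -(pmulr_lgt0 _ ed0); apply: lt_le_trans m_ge.
  by rewrite mulr_gt0 ?addr_gt0// mulr_gt0// exprn_gt0// ltr_pwDr.
pose p i := pmass P (seed h s i).
have p_ge0 i x : 0 <= p i x by exact: pmass_ge0.
have sum_p i : \sum_x p i x = 1 by exact: sum_pmass.
have sum_w : \sum_v weight p v = 1 by exact: sum_weight_pmass.
have hash2 k (J : {set 'I_(n k)}) (v : 'I_(n k) -> 'I_m) : (#|J| <= 2)%N ->
    \sum_(x : {ffun 'I_(n k) -> 'I_m} | [forall a in J, x a == v a]) p (inl k) x =
    m%:R^-1 ^+ #|J|.
  move=> J2; rewrite -[in RHS](card_ord m).
  exact: (kwise_independent_pmass v (mX (inl k)) (h3 k) (leqW J2)).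
have sign4 k (J : {set 'I_(n k)}) (v : 'I_(n k) -> bool) : (#|J| <= 4)%N ->
    \sum_(x : {ffun 'I_(n k) -> bool} | [forall a in J, x a == v a]) p (inr k) x =
    2^-1 ^+ #|J|.
  move=> J4; rewrite -card_bool.
  exact: (kwise_independent_pmass v (mX (inr k)) (s4 k) J4).
have [r [U [C [rd UU bAE]]]] := exists_orthonormal_span (row_mx b (kron A)).
(* The squared Frobenius norm of the Gram error compressed to the span of [U]. *)
pose F (v : {dffun forall i : 'I_q + 'I_q, seed_type m n i}) :=
  \sum_i \sum_j (U^T *m gram_error R v *m U) i j ^+ 2.
have F0 v : 0 <= F v.
  by apply: sumr_ge0 => i _; apply: sumr_ge0 => j _; exact: sqr_ge0.
have normU i : norm2 (col i U) ^+ 2 = 1.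
  have -> : norm2 (col i U) ^+ 2 = (U^T *m U) i i.
    by rewrite sqr_norm2 !mxE; apply: eq_bigr => c _; rewrite !mxE.
  by rewrite UU mxE eqxx.
(* Each of the [r^2] entries is an error form at two unit vectors, with second moment at most
   [3^q / m]. *)
have meanF : mean p F <= r%:R ^+ 2 * (3 ^+ q / m%:R).
  have -> : mean p F = \sum_i \sum_j
      mean p (fun v => error_form v (col i U) (col j U) ^+ 2).
    rewrite [RHS]pair_bigA exchange_big /=; apply: eq_bigr => v _.
    rewrite -mulr_sumr; congr (_ * _); rewrite -(pair_bigA _ (fun i j =>
      error_form v (col i U) (col j U) ^+ 2)).
    by apply: eq_bigr => i _; apply: eq_bigr => j _; rewrite error_formE.
  apply: (@le_trans _ _ (\sum_(i < r) \sum_(j < r) (3 ^+ q / m%:R))); last first.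
    by rewrite !sumr_const !card_ord -mulrnA -[leLHS]mulr_natl natrM expr2.
  apply: ler_sum => i _; apply: ler_sum => j _.
  have := mean_sqr_error_form_le m_gt0 p_ge0 sum_p sum_w hash2 sign4
    (col i U) (col j U).
  by rewrite !normU !mulr1.
have t0 : 0 < (eps / 2) ^+ 2 by rewrite exprn_gt0// divr_gt0.
apply: (@le_trans _ _ (P [set w | F (X w) <= (eps / 2) ^+ 2])); last first.
  apply: le_measure; rewrite ?inE//; first exact: (mJ [set v | F v <= _]).
  move=> w Fw xt; rewrite SX => xtP.
  exact: sketched_argmin_le bAE UU eps01 Fw xtP.
rewrite (probability_pmass P [pred v | F v <= (eps / 2) ^+ 2] mJ) lee_fin.
have -> : \sum_(v | F v <= (eps / 2) ^+ 2) pmass P X v =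
    \sum_(v | F v <= (eps / 2) ^+ 2) weight p v.
  by apply: eq_bigr => v _; exact: pmass_joint.
(* With Markov at threshold [(eps / 2)^2], it remains to bound [mean p F] by
   [delta * (eps / 2)^2]. *)
apply: le_trans (markov_weight p_ge0 sum_w F0 t0); rewrite lerD2l lerN2.
rewrite ler_pdivrMr//; apply: le_trans meanF _.
have rD : r%:R <= D + 1.
  rewrite addrC -[1]/(1%:R) -natrD; apply: le_trans (_ : (1 + \prod_k d k)%N%:R <= _).
    by rewrite ler_nat.
  by rewrite natrD.
have rD2 : r%:R ^+ 2 <= (D + 1) ^+ 2.
  by rewrite ler_pXn2r// nnegrE// addr_ge0.
rewrite mulrA ler_pdivrMr ?ltr0n//.
have r0 : 0 <= r%:R ^+ 2 :> R by exact: sqr_ge0.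
(* The constant 2 is the 8 of [m_ge] divided by the 4 coming from [(eps / 2)^2]. *)
apply: (@le_trans _ _ (2 * ((D + 1) ^+ 2 * (2 + 3 ^+ q)))).
  have : r%:R ^+ 2 * 3 ^+ q <= (D + 1) ^+ 2 * (2 + 3 ^+ q) :> R.
    by rewrite ler_pM// ?(ltW q3)// lerDr.
  have := mulr_ge0 r0 (ltW q3).
  by move: (_ * 3 ^+ q) (_ * (2 + _)) => x y *; lra.
by rewrite expr_div_n; lra.
Qed.
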